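(* Let $n$ be a positive integer and let $L$ be an $n\times n$ symmetric matrix with elements in $\mathbb{Z}/2\mathbb{Z}$ such that the entries on the main diagonal are all zero. Write $\vec l_k$ for the $k$th row of $L$. For each $k$ from $1$ to $n$ inclusive, let $O_k$ be a subset of $K(\vec l_k)-\{[\vec 0]\}$ containing an even number of $k$-odd orbits. Then there exists an $n$-component Gauss phrase $p$ such that $S_k(p)=(\vec l_k,O_k)$ for all $k$.
   Context: A word on an alphabet (finite set) $\mathcal{A}$ is a finite, possibly empty, sequence of letters of $\mathcal{A}$. A Gauss word on $\mathcal{A}$ is a word on $\mathcal{A}$ in which every letter of $\mathcal{A}$ appears exactly twice. A Gauss phrase on $\mathcal{A}$ is a finite sequence of words $x_1,\dots,x_m$ on $\mathcal{A}$ whose concatenation $x_1x_2\cdots x_m$ is a Gauss word on $\mathcal{A}$; the $x_i$ are its components. Write $K_n=(\mathbb{Z}/2\mathbb{Z})^n$. For $\vec u\in K_n$, let $c_{\vec u}:K_n\to K_n$, $c_{\vec u}(\vec v)=\vec u+\vec v$, and let $K(\vec u)$ be the set of orbits of $K_n$ under $c_{\vec u}$ (so the orbit of $\vec v$ is $[\vec v]=\{\vec v,\vec u+\vec v\}$). If the $k$th entry of $\vec u$ is $0$, all vectors in an orbit in $K(\vec u)$ have the same $k$th entry, and the orbit is called $k$-odd if this entry is $1$. Let $p$ be an $n$-component Gauss phrase. For a (contiguous) subword $w$ of a component of $p$, the linking vector $\overrightarrow{l(w)}\in K_n$ is the vector whose $i$th entry is the number, modulo $2$, of letters which occur exactly once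 in $w$ and whose other occurrence is in the $i$th component of $p$. A single-component letter is a letter both of whose occurrences are in the same component. If $A$ is a single-component letter in the $k$th component, that component has the form $xAyAz$ with $x,y,z$ possibly empty words, and the linking vector of $A$ is $\overrightarrow{l(A)}=\overrightarrow{l(y)}$. Let $\vec l_k(p)$ be the linking vector of the whole $k$th component of $p$, let $\mathcal{A}_k$ be the set of single-component letters appearing in the $k$th component, and for $[\vec v]\in K(\vec l_k(p))$ let $d_k([\vec v])=\#\{X\in\mathcal{A}_k : \overrightarrow{l(X)}\in[\vec v]\}$. Define $$O_k(p)=\{[\vec v]\in K(\vec l_k(p))-\{[\vec 0]\} : d_k([\vec v])\text{ is odd}\}$$ and $S_k(p)=(\vec l_k(p),O_k(p))$. *)

(* Defs.v *)
From HB Require Import structures.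
From mathcomp Require Import all_boot all_order all_algebra.
Set Implicit Arguments.
Unset Strict Implicit.
Unset Printing Implicit Defensive.
Import GRing.Theory.
Local Open Scope ring_scope.

Section Orbits.
Variable n : nat.
Implicit Types u v : 'rV['Z_2]_n.

Definition translation u v : 'rV['Z_2]_n := u + v.

Definition orb u v : {set 'rV['Z_2]_n} := [set w in orbit (translation u) v].

Definition Korb u : {set {set 'rV['Z_2]_n}} := [set orb u v | v : 'rV['Z_2]_n].

(* Only meaningful for o in Korb u with u 0 k = 0: then o is nonempty and all
   of its vectors have the same k-th entry. *)
Definition k_odd (k : 'I_n) (o : {set 'rV['Z_2]_n}) : bool :=
  [forall v in o, v 0 k == 1].

Lemma orbE u v : orb u v = [set v; u + v].
Proof.
have uu : u + u = 0.
  apply/rowP => i; rewrite !mxE; apply/val_inj => /=.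
  by case: (u 0 i) => [[|[|]]].
apply/setP => w; rewrite inE -fconnect_orbit !inE.
apply/idP/orP => [/iter_findex <-|[/eqP->|/eqP->]]; last 2 first.
- exact: connect0.
- exact: (fconnect1 (translation u)).
elim: (findex _ _ _) => [|m IHm] /=; first by left.
case: IHm => /eqP->; first by right.
by left; rewrite /translation addrA uu add0r.
Qed.

End Orbits.

Section GaussPhrases.
Variable A : finType.

Definition gauss_word (w : seq A) : Prop := forall a : A, count_mem a w = 2%N.

Variable n : nat.
Implicit Types (p : n.-tuple (seq A)) (i k : 'I_n) (a : A).

Definition gauss_phrase p : Prop := gauss_word (flatten p).

(* A contiguous subword must be known together with its place in the phrase
   (in the phrase a|a, the subword a of the first component and that of the
   second one have different linking vectors), so it is given by a component k
   and positions s <= e; it consists of the letters at positions s, ..., e-1. *)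
Definition subword (c : seq A) (s e : nat) : seq A := take (e - s) (drop s c).

Definition off_subword (c : seq A) (s e : nat) : seq A := take s c ++ drop e c.

Definition linking p k (s e : nat) : 'rV['Z_2]_n :=
  \row_i #|[set a | (count_mem a (subword (tnth p k) s e) == 1%N)
                 && (a \in (if i == k then off_subword (tnth p k) s e
                            else tnth p i))]|%:R.

Definition first_pos (c : seq A) a : nat := index a c.

Definition second_pos (c : seq A) a : nat :=
  ((first_pos c a).+1 + index a (drop (first_pos c a).+1 c))%N.

Definition linking_letter p k a : 'rV['Z_2]_n :=
  linking p k (first_pos (tnth p k) a).+1 (second_pos (tnth p k) a).

Definition linking_component p k : 'rV['Z_2]_n :=
  linking p k 0 (size (tnth p k)).

Definition single_letters p k : {set A} :=
  [set a | count_mem a (tnth p k) == 2%N].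

Definition d_count p k (o : {set 'rV['Z_2]_n}) : nat :=
  #|[set a in single_letters p k | linking_letter p k a \in o]|.

Definition O_inv p k : {set {set 'rV['Z_2]_n}} :=
  [set o in Korb (linking_component p k) :\ orb (linking_component p k) 0
    | odd (d_count p k o)].

Definition S_inv p k : 'rV['Z_2]_n * {set {set 'rV['Z_2]_n}} :=
  (linking_component p k, O_inv p k).

End GaussPhrases.

(* Main.v *)
(* Juxtaposing phrases on disjoint alphabets component by component adds their
   linking vectors and their counts d_k, since the linking vector of a
   single-component letter does not change.  It thus suffices to find phrases
   with the right parities of the d_k, and then to correct the linking matrix
   with a phrase that has no single-component letter.  For the parities, for
   each k and each v representing an orbit of O_k, take a phrase "A y A ..." in
   component k, where y has one letter shared with component i for each i != k
   with v_i = 1; if v_k = 1, a further letter B crosses A.  Then A has linking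
   vector v, and B has linking vector v_k e_k.  As O_k has an even number of
   k-odd orbits, the contributions of the letters B cancel modulo 2, except in
   the excluded orbit of 0. *)
Require Import Defs.
From HB Require Import structures.
From mathcomp Require Import all_boot all_order all_algebra.
From mathcomp Require Import zify.
Set Implicit Arguments.
Unset Strict Implicit.
Unset Printing Implicit Defensive.
Import GRing.Theory.
Local Open Scope ring_scope.

(** * Counting in finite types and splitting a word at a letter *)

Lemma Z2_natr (x : 'Z_2) : x = (x != 0)%:R.
Proof. by apply/val_inj; case: x => [[|[|]]]. Qed.

(** Serves to read off the entries of linking vectors to which at most one letter can contribute. *)
Lemma card_set_pred1 (T : finType) (P : pred T) (a : T) (b : bool) :
  (forall x, P x = (x == a) && b) -> #|[set x | P x]| = b.
Proof.
move=> Pa; case: b Pa => Pa.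
  by rewrite (_ : [set x | P x] = [set a]) ?cards1 //; apply/setP => x; rewrite !inE Pa andbT.
by apply: eq_card0 => x; rewrite !inE Pa andbF.
Qed.

Lemma card_set_sum (A B : finType) (P : pred (A + B)) :
  #|[set x | P x]| = (#|[set a | P (inl a)]| + #|[set b | P (inr b)]|)%N.
Proof. by rewrite -!sum1dep_card big_sumType. Qed.

Lemma card_set_sub (T : finType) (P Q : pred T) :
  #|[set x : {x | P x} | Q (val x)]| = #|[set x | P x && Q x]|.
Proof.
rewrite -(card_imset _ val_inj); apply: eq_card => x; rewrite !inE.
apply/imsetP/andP => [[y]|[Px Qx]]; first by rewrite inE => Qy ->; split=> //; apply: valP.
by exists (Sub x Px); rewrite ?inE ?SubK.
Qed.

Lemma mem_split (T : eqType) (a : T) (c : seq T) : a \in c ->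
  exists x y, c = x ++ a :: y /\ a \notin x.
Proof.
move=> ac; exists (take (index a c) c), (drop (index a c).+1 c).
by rewrite -drop_index // cat_take_drop in_take // ltnn.
Qed.

Lemma count2_split (T : eqType) (a : T) (c : seq T) : count_mem a c = 2%N ->
  exists x y z, [/\ c = x ++ a :: y ++ a :: z, a \notin x & a \notin y].
Proof.
move=> c2; have /mem_split[x [c' [cE ax]]]: a \in c by rewrite -has_pred1 has_count c2.
have /mem_split[y [z [c'E ay]]]: a \in c'.
  move: c2; rewrite cE count_cat /= eqxx (count_memPn ax) -has_pred1 has_count; lia.
by exists x, y, z; rewrite -c'E.
Qed.

(** * Explicit forms of linking vectors *)

Section Linking.
Variables (A : finType) (n : nat).
Implicit Types (p : n.-tuple (seq A)) (i k : 'I_n) (a : A).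

Lemma gauss_phraseE p :
  gauss_phrase p <-> forall a, (\sum_i count_mem a (tnth p i) = 2)%N.
Proof.
suff E a : count_mem a (flatten p) = (\sum_i count_mem a (tnth p i))%N.
  by split=> H a; [rewrite -E | rewrite E]; apply: H.
by rewrite count_flatten sumnE big_map big_tuple.
Qed.

Lemma linking_componentE p k : linking_component p k =
  \row_i (if i == k then 0 else
    #|[set a | (count_mem a (tnth p k) == 1%N) && (a \in tnth p i)]|%:R).
Proof.
apply/rowP => i; rewrite !mxE /subword subn0 drop0 take_size.
case: eqP => // _; rewrite /off_subword take0 drop_size /=.
by rewrite eq_card0 // => a; rewrite inE in_nil andbF.
Qed.

Lemma linking_component_diag p k : linking_component p k 0 k = 0.
Proof. by rewrite linking_componentE mxE eqxx. Qed.

(** As the occurrences of a letter add up to two, a letter occurring once in component [k] and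
    somewhere in another component [i] occurs once in each; this condition is symmetric. *)
Lemma linking_component_sym p k i : gauss_phrase p ->
  linking_component p k 0 i = linking_component p i 0 k.
Proof.
move/gauss_phraseE => gp; rewrite !linking_componentE !mxE eq_sym.
case: eqVneq => // ki; congr (_%:R); apply: eq_card => a; rewrite !inE.
move: (gp a); rewrite (bigD1 i) //= (bigD1 k) //= -!has_pred1 !has_count.
by move: (count_mem _ (tnth p i)) (count_mem _ (tnth p k)) => u v; lia.
Qed.

(** The conditions on [x] and [y] force the two displayed occurrences of [a] to be those found by
    [first_pos] and [second_pos]. *)
Lemma linking_letterE p k a x y z :
  tnth p k = x ++ a :: y ++ a :: z -> a \notin x -> a \notin y ->
  linking_letter p k a = \row_i #|[set b | (count_mem b y == 1%N)
    && (b \in (if i == k then x ++ [:: a, a & z] else tnth p i))]|%:R.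
Proof.
move=> pk ax ay; apply/rowP => i.
have f1 : first_pos (tnth p k) a = size x.
  by rewrite /first_pos pk index_cat (negPf ax) /= eqxx addn0.
have d1 : drop (size x).+1 (tnth p k) = y ++ a :: z.
  by rewrite pk -cat_rcons drop_size_cat // size_rcons.
have f2 : second_pos (tnth p k) a = ((size x).+1 + size y)%N.
  by rewrite /second_pos f1 d1 index_cat (negPf ay) /= eqxx addn0.
rewrite !mxE f1 f2 /subword d1 addKn take_size_cat //.
congr (_%:R); apply: eq_card => b; rewrite !inE; congr (_ && (b \in _)).
case: eqP => // _; rewrite /off_subword addnC -drop_drop d1 drop_size_cat //.
by rewrite pk -(cat_rcons _ x (y ++ _)) take_size_cat ?size_rcons // cat_rcons.
Qed.

End Linking.

(** * Juxtaposition of phrases on disjoint alphabets *)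

Section Juxtaposition.
Variables (A B : finType) (n : nat).
Variables (p : n.-tuple (seq A)) (q : n.-tuple (seq B)).
Implicit Types (k : 'I_n).

Definition juxt : n.-tuple (seq (A + B)) :=
  [tuple map inl (tnth p i) ++ map inr (tnth q i) | i < n].

Lemma count_map_inl (a : A) s : count_mem (inl a : A + B) (map inl s) = count_mem a s.
Proof. by rewrite count_map; apply: eq_count. Qed.

Lemma count_map_inr (b : B) s : count_mem (inr b : A + B) (map inr s) = count_mem b s.
Proof. by rewrite count_map; apply: eq_count. Qed.

Lemma count_inl_map_inr (a : A) (s : seq B) : count_mem (inl a) (map inr s) = 0%N.
Proof. by rewrite count_map; elim: s. Qed.

Lemma count_inr_map_inl (b : B) (s : seq A) : count_mem (inr b) (map inl s) = 0%N.
Proof. by rewrite count_map; elim: s. Qed.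

Definition count_inE :=
  (count_map_inl, count_map_inr, count_inl_map_inr, count_inr_map_inl).

Lemma mem_map_inl (a : A) s : ((inl a : A + B) \in map inl s) = (a \in s).
Proof. by rewrite mem_map // => ? ? []. Qed.

Lemma mem_map_inr (b : B) s : ((inr b : A + B) \in map inr s) = (b \in s).
Proof. by rewrite mem_map // => ? ? []. Qed.

Lemma inl_notin_map_inr (a : A) (s : seq B) : (inl a \in map inr s) = false.
Proof. by elim: s. Qed.

Lemma inr_notin_map_inl (b : B) (s : seq A) : (inr b \in map inl s) = false.
Proof. by elim: s. Qed.

Definition mem_inE :=
  (mem_map_inl, mem_map_inr, inl_notin_map_inr, inr_notin_map_inl).

Lemma juxt_gauss : gauss_phrase p -> gauss_phrase q -> gauss_phrase juxt.
Proof.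
move=> /gauss_phraseE gp /gauss_phraseE gq; apply/gauss_phraseE => -[c|c].
  by rewrite -(gp c); apply: eq_bigr => i _; rewrite tnth_mktuple count_cat !count_inE addn0.
by rewrite -(gq c); apply: eq_bigr => i _; rewrite tnth_mktuple count_cat !count_inE.
Qed.

Lemma juxt_linking_component k : linking_component juxt k =
  linking_component p k + linking_component q k.
Proof.
rewrite !linking_componentE; apply/rowP => i; rewrite !mxE.
case: eqP => _; first by rewrite addr0.
rewrite card_set_sum natrD; congr (_%:R + _%:R); apply: eq_card => c;
by rewrite !inE !tnth_mktuple count_cat mem_cat !count_inE !mem_inE ?addn0 ?orbF.
Qed.

(** Both occurrences lie in the [p] part of the component, so only letters of [p] stand between
    them, and their other occurrences keep their places. *)
Lemma juxt_linking_letter_inl k (a : A) : count_mem a (tnth p k) = 2%N ->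
  linking_letter juxt k (inl a) = linking_letter p k a.
Proof.
case/count2_split => x [y] [z] [pk ax ay].
rewrite (linking_letterE pk) //.
rewrite (@linking_letterE _ _ _ _ _ (map inl x) (map inl y) (map inl z ++ map inr (tnth q k)));
  rewrite ?mem_inE //; last by rewrite tnth_mktuple pk !(map_cat, map_cons) -!catA /= -catA.
apply/rowP => i; rewrite !mxE card_set_sum addnC eq_card0 ?add0n.
  congr (_%:R); apply: eq_card => c; rewrite !inE count_inE; congr andb.
  by case: eqP => _; rewrite ?tnth_mktuple !(mem_cat, inE) !mem_inE ?orbF.
by move=> b; rewrite inE count_inE.
Qed.

Lemma juxt_linking_letter_inr k (b : B) : count_mem b (tnth q k) = 2%N ->
  linking_letter juxt k (inr b) = linking_letter q k b.
Proof.
case/count2_split => x [y] [z] [qk bx biy].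
rewrite (linking_letterE qk) //.
rewrite (@linking_letterE _ _ _ _ _ (map inl (tnth p k) ++ map inr x) (map inr y) (map inr z));
  rewrite ?mem_cat ?mem_inE //; last by rewrite tnth_mktuple qk !(map_cat, map_cons) -!catA.
apply/rowP => i; rewrite !mxE card_set_sum eq_card0 ?add0n.
  congr (_%:R); apply: eq_card => c; rewrite !inE count_inE; congr andb.
  by case: eqP => _; rewrite ?tnth_mktuple !(mem_cat, inE) !mem_inE.
by move=> a; rewrite inE count_inE.
Qed.

Lemma juxt_d_count k (o : {set 'rV['Z_2]_n}) :
  d_count juxt k o = (d_count p k o + d_count q k o)%N.
Proof.
rewrite /d_count card_set_sum; congr addn; apply: eq_card => c;
rewrite !inE tnth_mktuple count_cat !count_inE ?addn0 ?add0n; case: eqP => //= c2.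
- by rewrite juxt_linking_letter_inl.
- by rewrite juxt_linking_letter_inr.
Qed.

End Juxtaposition.

Lemma Some_eqE (T : eqType) (x y : T) : (Some x == Some y) = (x == y).
Proof. by []. Qed.

(** * The phrase realizing one given vector in component [k] *)

Section Atom.
Variables (n : nat) (k : 'I_n) (v : 'rV['Z_2]_n).

(* [None] is A, [Some k] is B and [legs true] is y; the letters of [legs false]
   are there only because every letter must occur twice. *)
Definition legs (b : bool) : seq (option 'I_n) :=
  [seq Some i | i <- enum [pred i | (i != k) && ((v 0 i != 0) == b)]].

(** After the prefix the word is A y B A B or A y A B B: when v_k = 0, the letter B is crossed by
    nothing and has linking vector 0. *)
Definition atom_word : seq (option 'I_n) :=
  legs false ++ None :: legs true ++
  (if v 0 k != 0 then [:: Some k; None; Some k] else [:: None; Some k; Some k]).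

Definition atom : n.-tuple (seq (option 'I_n)) :=
  [tuple if i == k then atom_word else [:: Some i] | i < n].

Lemma mem_legs b i : (Some i \in legs b) = (i != k) && ((v 0 i != 0) == b).
Proof. by rewrite mem_map ?mem_enum //; apply: Some_inj. Qed.

Lemma None_notin_legs b : (None \in legs b) = false.
Proof. by apply/mapP => -[]. Qed.

Lemma count_legs b c : count_mem c (legs b) = (c \in legs b).
Proof. by rewrite count_uniq_mem // map_inj_uniq ?enum_uniq //; apply: Some_inj. Qed.

Lemma count_atom_word c :
  count_mem c atom_word = if c is Some i then (if i == k then 2 else 1)%N else 2%N.
Proof.
rewrite /atom_word count_cat /= count_cat !count_legs.
case: c => [i|]; rewrite ?mem_legs ?None_notin_legs; last by case: ifP.
case: (eqVneq i k) => [->|/negPf ik]; case: ifP => _ /=; rewrite !Some_eqE ?eqxx //;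
  by rewrite (eq_sym k) ik; case: (v 0 i != 0).
Qed.

Lemma atom_gauss : gauss_phrase atom.
Proof.
apply/gauss_phraseE => c; rewrite (bigD1 k) //= tnth_mktuple eqxx count_atom_word.
under eq_bigr => i ik do rewrite tnth_mktuple (negPf ik) /= addn0.
case: c => [j|]; last by rewrite big1.
case: eqVneq => [->|jk].
  by rewrite big1 // => i /negPf ik; rewrite -[RHS]/(nat_of_bool false) -ik.
rewrite (bigD1 j) //= eqxx big1 // => i /andP[_ /negPf ij].
by rewrite -[RHS]/(nat_of_bool false) -ij.
Qed.

Lemma atom_letter_None : linking_letter atom k None = v.
Proof.
have tk : tnth atom k = atom_word by rewrite tnth_mktuple eqxx.
(* Both cases at once: B occurs [b] times before the second A and 2 - [b] times after it. *)
pose b := v 0 k != 0.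
rewrite (@linking_letterE _ _ _ _ _ (legs false)
  (legs true ++ nseq b (Some k)) (nseq (~~ b).+1 (Some k))).
- apply/rowP => i; rewrite mxE [RHS]Z2_natr; congr (_%:R).
  (* Only [Some i] can count in entry [i]: a leg leading to component [i] if i != k, and B itself if
     i = k. *)
  apply: (@card_set_pred1 _ _ (Some i)) => c.
  rewrite count_uniq_mem; last first.
    rewrite cat_uniq map_inj_uniq ?enum_uniq; last exact: Some_inj.
    by case: b; rewrite //= orbF mem_legs eqxx.
  rewrite eqb1 !mem_cat !mem_nseq.
  case: c => [j|]; last first.
    by rewrite None_notin_legs /= andbF.
  rewrite tnth_mktuple Some_eqE.
  rewrite mem_legs.
  have [->|ik] := eqVneq i k.
    rewrite !(mem_cat, inE) mem_nseq mem_legs /= /b.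
    rewrite !Some_eqE; have [->|jk] := eqVneq j k; case: (v 0 k != 0) => //=.
    1,2: by case: (v 0 j != 0).
  rewrite inE !Some_eqE.
  have [->|_] := eqVneq j i; last by rewrite andbF.
  by rewrite (negPf ik) /= andbF andbT orbF eqb_id.
- by rewrite tk /atom_word -/b; case: b; rewrite -?catA ?cats0.
- by rewrite None_notin_legs.
- by rewrite mem_cat None_notin_legs mem_nseq andbF.
Qed.

Lemma atom_letter_Some :
  linking_letter atom k (Some k) = if v 0 k != 0 then delta_mx 0 k else 0.
Proof.
have tk : tnth atom k = atom_word by rewrite tnth_mktuple eqxx.
pose b := v 0 k != 0.
(* Between the two B's stands A alone if they cross, and nothing otherwise. *)
rewrite (@linking_letterE _ _ _ _ _ (legs false ++ None :: legs true ++ nseq (~~ b) None)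
  (nseq b None) [::]).
- apply/rowP => i; rewrite mxE.
  rewrite (@card_set_pred1 _ _ None (b && (i == k))).
    by rewrite /b; case: ifP => _; rewrite !mxE ?eqxx //=.
  move=> c; rewrite tnth_mktuple.
  case: (i == k).
    by rewrite /b; case: c => [j|]; case: (v 0 k != 0) => //=; rewrite !mem_cat !inE !orbT.
  by rewrite inE; case: c => [j|]; case: b => //=; rewrite ?andbF.
- by rewrite tk /atom_word -/b; case: b; rewrite /= -?catA /= -?catA ?cats0.
- by rewrite mem_cat inE mem_cat !mem_legs eqxx mem_nseq andbF.
- by rewrite mem_nseq andbF.
Qed.

(** A and B are the only single-component letters: each leg occurs once in component [k] and once
    elsewhere. *)
Lemma atom_d_count i o : d_count atom i o =
  ((i == k) * ((v \in o) + ((if v 0 k != 0 then delta_mx 0 k else 0)%R \in o)))%N.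
Proof.
rewrite /d_count -sum1dep_card.
have [->|ik] := eqVneq i k; last first.
  rewrite big1 // => c; rewrite inE tnth_mktuple (negPf ik) /=.
  by case: (Some i == c).
have in1 c : c \in single_letters atom k = if c is Some j then j == k else true.
  by rewrite inE tnth_mktuple eqxx count_atom_word; case: c => // j; case: (j == k).
rewrite mul1n big_mkcond (bigD1 None) // (bigD1 (Some k)) //= !in1 eqxx /=.
rewrite atom_letter_None atom_letter_Some big1 ?addn0; last first.
  by move=> [j|] /andP[//= _]; rewrite Some_eqE in1 => /negPf ->.
by congr addn; case: (_ \in o).
Qed.

End Atom.

(** * A phrase with a prescribed linking matrix and no single-component letter *)

Section Edges.
Variables (n : nat) (M : 'M['Z_2]_n).

(** The edges of the graph with adjacency matrix [M], each taken once through the order of its ends;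
    component [i] of [edges] lists those incident to [i]. *)
Definition edge : finType :=
  {e : 'I_n * 'I_n | (e.1 < e.2)%N && (M e.1 e.2 != 0)}.

Definition edges : n.-tuple (seq edge) :=
  [tuple enum [pred e : edge | ((val e).1 == i) || ((val e).2 == i)] | i < n].

Lemma edge_neq (e : edge) : (val e).1 != (val e).2.
Proof. by have /andP[+ _] := valP e; rewrite ltn_neqAle => /andP[]. Qed.

Lemma count_edges i e :
  count_mem e (tnth edges i) = (((val e).1 == i) + ((val e).2 == i))%N.
Proof.
rewrite tnth_mktuple count_uniq_mem ?enum_uniq // mem_enum inE.
by case: (eqVneq _ i) => [<-|] //=; rewrite eq_sym (negPf (edge_neq e)).
Qed.

Lemma edges_gauss : gauss_phrase edges.
Proof.
apply/gauss_phraseE => e; under eq_bigr => i _ do rewrite count_edges.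
rewrite big_split /= (bigD1 (val e).1) // [X in (_ + X)%N](bigD1 (val e).2) //= !eqxx.
by rewrite !big1 // => i; rewrite eq_sym => /negPf ->.
Qed.

Lemma edges_d_count k o : d_count edges k o = 0%N.
Proof.
apply: eq_card0 => e; rewrite !inE count_edges.
case: (eqVneq _ k) => [<-|_]; first by rewrite [(val e).2 == _]eq_sym (negPf (edge_neq e)).
by case: (_ == k).
Qed.

Lemma edges_linking_component k : M^T = M -> (forall i, M i i = 0) ->
  linking_component edges k = row k M.
Proof.
move=> /matrixP Msym Mdiag; rewrite linking_componentE; apply/rowP => i; rewrite !mxE.
case: eqVneq => [->|ik]; first by rewrite Mdiag.
rewrite [RHS]Z2_natr; congr (_%:R).
under eq_finset => e do
  rewrite tnth_mktuple count_uniq_mem ?enum_uniq // eqb1 tnth_mktuple !mem_enum !inE.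
rewrite (card_set_sub _ (fun e : 'I_n * 'I_n =>
  ((e.1 == k) || (e.2 == k)) && ((e.1 == i) || (e.2 == i)))).
(* The one edge that can join [i] and [k] is the pair with the smaller index first. *)
apply: (@card_set_pred1 _ _ (if (i < k)%N then (i, k) else (k, i))) => -[x y] /=.
have := Msym i k; rewrite mxE => Mik.
case: (ltngtP i k) => [lt|gt|/val_inj e]; last by rewrite e eqxx in ik.
- rewrite xpair_eqE; apply/idP/idP => [|/andP[/andP[/eqP-> /eqP->]]].
    case/andP => /andP[xy Mxy] /andP[/orP[]/eqP e1 /orP[]/eqP e2]; subst.
    + by rewrite eqxx in ik.
    + by rewrite ltnNge ltnW in xy.
    + by rewrite !eqxx Mik.
    + by rewrite eqxx in ik.
  by rewrite lt !eqxx !orbT Mik => ->.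
- rewrite xpair_eqE; apply/idP/idP => [|/andP[/andP[/eqP-> /eqP->]]].
    case/andP => /andP[xy Mxy] /andP[/orP[]/eqP e1 /orP[]/eqP e2]; subst.
    + by rewrite eqxx in ik.
    + by rewrite !eqxx.
    + by rewrite ltnNge ltnW in xy.
    + by rewrite eqxx in ik.
  by rewrite gt !eqxx !orbT => ->.
Qed.

End Edges.

(** * Orbits and their representatives *)

Section Orbits.
Variable n : nat.
Implicit Types (u v : 'rV['Z_2]_n) (o : {set 'rV['Z_2]_n}).

Lemma addvv u : u + u = 0.
Proof. by apply/rowP => i; rewrite !mxE; apply/val_inj; case: (u 0 i) => [[|[|]]]. Qed.

Lemma Korb_eq u o v : o \in Korb u -> v \in o -> o = orb u v.
Proof.
case/imsetP => w _ ->; rewrite orbE => /set2P[] -> //; first by rewrite orbE.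
by rewrite orbE addrA addvv add0r setUC.
Qed.

(** The default 0 is never reached on an orbit, which is nonempty. *)
Definition rep o : 'rV['Z_2]_n := odflt 0 [pick v in o].

Lemma rep_in u o : o \in Korb u -> rep o \in o.
Proof.
case/imsetP => w _ ->; rewrite /rep; case: pickP => //= /(_ w).
by rewrite orbE set21.
Qed.

Lemma rep_inE u o o' : o \in Korb u -> o' \in Korb u -> (rep o' \in o) = (o' == o).
Proof.
move=> oK oK'; apply/idP/eqP => [ro|<-]; last exact: rep_in oK'.
by rewrite (Korb_eq oK ro) -(Korb_eq oK' (rep_in oK')).
Qed.

(** Adding [u] leaves the [k]-th entry unchanged, so any one vector of the orbit decides. *)
Lemma k_odd_rep u (k : 'I_n) o : u 0 k = 0 -> o \in Korb u ->
  k_odd k o = (rep o 0 k != 0).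
Proof.
move=> uk oK; have oE := Korb_eq oK (rep_in oK).
have -> : (rep o 0 k != 0) = (rep o 0 k == 1).
  by case: (rep o 0 k) => [[|[|]]].
apply/forall_inP/idP => [|r1 v]; first by apply; apply: rep_in oK.
by rewrite oE orbE => /set2P[] ->; rewrite // mxE uk add0r.
Qed.

(** Orbits are disjoint, so only the term o' = [o] survives; this makes the letters A contribute
    exactly the indicator of the chosen set. *)
Lemma sum_rep_in (u : 'rV['Z_2]_n) (Os : {set {set 'rV['Z_2]_n}}) o :
  Os \subset Korb u -> o \in Korb u ->
  (\sum_(o' in Os) (rep o' \in o))%N = (o \in Os).
Proof.
move=> /subsetP sub oK.
under eq_bigr => o' oO do rewrite (rep_inE oK (sub _ oO)).
have [oO|oO] := boolP (o \in Os).
  by rewrite (bigD1 o) //= eqxx big1 // => o' /andP[_ /negPf ->].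
by rewrite big1 // => o' oO'; case: eqP oO' oO => // -> ->.
Qed.

End Orbits.

(** * Assembling the phrase *)

Lemma exists_juxt_atoms n (s : seq ('I_n * 'rV['Z_2]_n)) :
  exists (A : finType) (p : n.-tuple (seq A)), gauss_phrase p /\
    forall i o, d_count p i o = (\sum_(x <- s) (i == x.1) *
      ((x.2 \in o) + ((if x.2 0 x.1 != 0 then delta_mx 0 x.1 else 0)%R \in o)))%N.
Proof.
elim: s => [|[k v] s [A [p [gp dp]]]].
  exists void, [tuple [::] | i < n]; split=> [[]|i o].
  by rewrite big_nil; apply: eq_card0; case.
exists (option 'I_n + A)%type, (juxt (atom k v) p).
split=> [|i o]; first exact: juxt_gauss (atom_gauss k v) gp.
by rewrite juxt_d_count atom_d_count dp big_cons.
Qed.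

Theorem proposition7p2 (n : nat) (n_gt0 : (0 < n)%N) (L : 'M['Z_2]_n)
    (L_sym : L^T = L) (L_diag : forall k : 'I_n, L k k = 0)
    (O : 'I_n -> {set {set 'rV['Z_2]_n}})
    (O_sub : forall k : 'I_n,
       O k \subset Korb (row k L) :\ orb (row k L) 0)
    (O_even : forall k : 'I_n, ~~ odd #|[set o in O k | k_odd k o]|) :
  exists (A : finType) (p : n.-tuple (seq A)),
    gauss_phrase p /\ forall k : 'I_n, S_inv p k = (row k L, O k).
Proof.
have [A [p [gp dp]]] := exists_juxt_atoms [seq (k, rep o) | k <- enum 'I_n, o <- enum (O k)].
(* The discrepancy between the wanted and the present linking matrix, which [edges M] makes up for
   without changing any count d_k. *)
pose M := \matrix_(i, k) (L i k - linking_component p i 0 k).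
have Msym : M^T = M.
  apply/matrixP => i k; rewrite [LHS]mxE [LHS]mxE [RHS]mxE.
  by rewrite linking_component_sym // -{1}L_sym mxE.
have Mdiag i : M i i = 0 by rewrite mxE L_diag linking_component_diag subr0.
exists (A + edge M)%type, (juxt p (edges M)).
split=> [|k]; first exact: juxt_gauss gp (@edges_gauss n M).
have lk : linking_component (juxt p (edges M)) k = row k L.
  rewrite juxt_linking_component edges_linking_component //.
  by apply/rowP => i; rewrite mxE [row k M 0 i]mxE [M k i]mxE [RHS]mxE addrC subrK.
rewrite /S_inv lk; congr pair; apply/setP => o; rewrite inE lk.
(* Outside the admissible orbits neither side contains [o]. *)
have [|oK] := boolP (o \in _ :\ _); last first.
  by apply/esym/negbTE; apply: contra oK; apply: (subsetP (O_sub k)).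
case/setD1P => o_n0 oK /=.
have OK : O k \subset Korb (row k L) by apply: subset_trans (O_sub k) (subsetDl _ _).
(* Hence a letter B with linking vector 0 never counts in [o]. *)
have o0 : 0 \notin o by apply: contraNN o_n0 => /(Korb_eq oK) {1}->.
rewrite juxt_d_count edges_d_count addn0 dp big_allpairs_dep.
rewrite big_enum /= (bigD1 k) //= [X in (_ + X)%N]big1 ?addn0; last first.
  by move=> i ik; rewrite big1_seq // => o' _; rewrite /= eq_sym (negPf ik).
under eq_bigr => o' _ do rewrite /= eqxx mul1n.
rewrite big_enum big_split /= (sum_rep_in OK oK) oddD oddb.
rewrite [X in _ (+) X](_ : _ = false) ?addbF //.
have rowk0 : row k L 0 k = 0 by rewrite mxE L_diag.
(* The remaining sum is the contribution of the letters B: each [k]-odd orbit of [O k] yields one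
   with vector e_k, so the sum is an even number times the indicator of e_k in [o]. *)
transitivity (odd (#|[set o in O k | k_odd k o]| * (delta_mx 0 k \in o))); last first.
  by rewrite oddM (negPf (O_even k)).
congr (odd _); rewrite -sum1dep_card big_distrl /= big_mkcondr /=; apply: eq_bigr => o' oO'.
rewrite (k_odd_rep rowk0 (subsetP OK _ oO')); case: ifP => _; first by rewrite mul1n.
by rewrite (negPf o0).
Qed.
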